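(* Let $\alpha: I\to\mathbb{E}^3$ be a unit-speed curve with $\kappa\neq 0$, and let $K(s,v)=\alpha(s)+vB(s)$ be the binormal surface of $\alpha$. Then the parameter curves of $K$ satisfy the following. (i) For fixed $v$, the $s$-parameter curve $s\mapsto K(s,v)$ is an asymptotic curve if and only if the curvature $\kappa$ and torsion $\tau$ of $\alpha$ satisfy the differential equation $$v\tau'-v^2\kappa\tau^2-\kappa=0.$$ (ii) For fixed $v$, the $s$-parameter curve $s\mapsto K(s,v)$ is a geodesic curve if and only if it is the base curve, i.e. $v=0$ and $K(s,0)=\alpha(s)$, or the base curve $\alpha$ is a plane curve. (iii) The $v$-parameter curves are straight lines. (iv) The parameter curves (both families) are lines of curvature if and only if the base curve $\alpha$ is a plane curve.
   Context: All maps are smooth and $I\subset\mathbb{R}$ is an open interval. For a unit-speed curve $\alpha$ with $\kappa=\|\alpha''\|>0$, the Frenet frame is $T=\alpha'$, $N=\alpha''/\|\alpha''\|$, $B=T\times N$, with $T'=\kappa N$, $N'=-\kappa T+\tau B$, $B'=-\tau N$. A plane curve is one with $\tau=0$. The unit normal of $K$ is $U=\frac{K_s\times K_v}{\|K_s\times K_v\|}$. The $s$-parameter curves are $s\mapsto K(s,v)$ with $v$ fixed, and the $v$-parameter curves are $v\mapsto K(s,v)$ with $s$ fixed. An $s$-parameter curve is a geodesic curve if its acceleration vector is normal to the surface, i.e. $U\times K_{ss}=0$ along it, and an asymptotic curve if its acceleration vector is tangent to the surface, i.e. $\langle U,K_{ss}\rangle=0$ along it (similarly for $v$-parameter curves with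 $K_{vv}$). A curve on the surface is a line of curvature if $S(t)$ and $t$ are linearly dependent along it, where $t$ is its tangent and $S$ is the shape operator of the surface. *)

(* Defs.v *)
From mathcomp Require Export all_boot all_order all_algebra.
From mathcomp Require Export all_classical all_reals all_analysis.
Export Order.TTheory GRing.Theory Num.Theory numFieldNormedType.Exports.

Set Implicit Arguments.
Unset Strict Implicit.
Unset Printing Implicit Defensive.

Local Open Scope ring_scope.
Local Open Scope classical_set_scope.

Definition dot (R : realType) (u w : 'rV[R]_3) : R := (u *m w^T) 0 0.

(* The library's norm on ['rV[R]_3] is the sup norm. *)
Definition enorm (R : realType) (u : 'rV[R]_3) : R := Num.sqrt (dot u u).

(* Indices are taken in ['I_3], i.e. modulo 3. *)
Definition cross (R : realType) (u w : 'rV[R]_3) : 'rV[R]_3 :=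
  \row_(k < 3) (u 0 (k + 1) * w 0 (k + 2%:R) - u 0 (k + 2%:R) * w 0 (k + 1)).

Definition open_interval (R : realType) (I : set R) : Prop :=
  [/\ I !=set0, open I & is_interval I].

Definition smooth_on (R : realType) (I : set R) (c : R -> 'rV[R]_3) : Prop :=
  forall (n : nat) (t : R), I t -> derivable (derive1n n c) t 1.

Definition unit_speed (R : realType) (I : set R) (c : R -> 'rV[R]_3) : Prop :=
  forall t, I t -> enorm (derive1 c t) = 1.

Section Frenet.
Variables (R : realType) (c : R -> 'rV[R]_3).

Definition curvature (t : R) : R := enorm (derive1n 2 c t).

Definition tangent (t : R) : 'rV[R]_3 := derive1 c t.

Definition normal (t : R) : 'rV[R]_3 :=
  (enorm (derive1n 2 c t))^-1 *: derive1n 2 c t.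

Definition binormal (t : R) : 'rV[R]_3 := cross (tangent t) (normal t).

(* The coefficient determined by B' = - torsion *: N. *)
Definition torsion (t : R) : R := - dot (derive1 binormal t) (normal t).

Definition plane_curve (I : set R) : Prop := forall t, I t -> torsion t = 0.

Definition binormal_surface (x : R * R) : 'rV[R]_3 :=
  c x.1 + x.2 *: binormal x.1.

End Frenet.

Definition straight_line (R : realType) (J : set R) (c : R -> 'rV[R]_3) : Prop :=
  exists p d : 'rV[R]_3, d != 0 /\ c @` J = range (fun t : R => p + t *: d).

Section Surface.
Variables (R : realType) (X : R * R -> 'rV[R]_3).

Definition partial_s (x : R * R) : 'rV[R]_3 := derive1 (fun s => X (s, x.2)) x.1.

Definition partial_v (x : R * R) : 'rV[R]_3 := derive1 (fun v => X (x.1, v)) x.2.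

(* The matrix of the differential, acting on row vectors on the right. *)
Definition differential_mx (x : R * R) : 'M[R]_(1 + 1, 3) :=
  col_mx (partial_s x) (partial_v x).

Definition unit_normal (x : R * R) : 'rV[R]_3 :=
  let n := cross (partial_s x) (partial_v x) in (enorm n)^-1 *: n.

End Surface.

(* S(w) is minus the derivative of the unit normal U in the direction w, i.e.
   S = - dU o dX^-1 on the tangent plane at X x, which is the row space of
   dX. At a regular point dX is injective, so [pinvmx] gives the coordinates of
   a tangent vector in the basis (X_s, X_v); for other vectors the value is
   meaningless. *)
Definition shape_operator (R : realType) (X : R * R -> 'rV[R]_3) (x : R * R)
    (w : 'rV[R]_3) : 'rV[R]_3 :=
  - (w *m pinvmx (differential_mx X x) *m differential_mx (unit_normal X) x).

(* A curve on the surface X is given by a path g in the parameter domain; the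
   curve itself is X \o g, with parameter in J. *)
Section CurveOnSurface.
Variables (R : realType) (X : R * R -> 'rV[R]_3).
Variables (J : set R) (g : R -> R * R).

Definition geodesic_curve : Prop :=
  forall t, J t -> cross (unit_normal X (g t)) (derive1n 2 (X \o g) t) = 0.

Definition asymptotic_curve : Prop :=
  forall t, J t -> dot (unit_normal X (g t)) (derive1n 2 (X \o g) t) = 0.

Definition line_of_curvature : Prop :=
  forall t, J t ->
    let w := derive1 (X \o g) t in ~~ free [:: shape_operator X (g t) w; w].

End CurveOnSurface.

Definition s_curve (R : realType) (v : R) : R -> R * R := fun s => (s, v).

Definition v_curve (R : realType) (s : R) : R -> R * R := fun v => (s, v).

(* Main.v *)
Require Import Defs.
From mathcomp Require Import all_boot all_order all_algebra.
From mathcomp Require Import all_classical all_reals all_analysis.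
From mathcomp Require Import ring.

(* The Frenet equations give K_s = T - v tau N and K_v = B, so the unit normal
   is a positive multiple of -v tau T - N, while
   K_ss = v kappa tau T + (kappa - v tau') N - v tau^2 B. Taking the dot and
   cross products in the frame (T, N, B) yields (i) and (ii).
   For (iv), along v = 0 the frame (K_s, K_v) = (T, B) is orthonormal and
   S(B) = - U_v has T-component tau, so S(B) is parallel to B only if tau = 0;
   conversely tau = 0 gives U = -N, hence S(T) = - kappa T and S(B) = 0. *)

Set Implicit Arguments.
Unset Strict Implicit.
Unset Printing Implicit Defensive.

Local Open Scope ring_scope.
Local Open Scope classical_set_scope.

(** * Dot and cross products in coordinates, and coordinates in an orthonormal frame *)

Section VectorAlgebra.
Variable R : realType.
Implicit Types (u w x y T N : 'rV[R]_3) (a b c : R).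

Lemma dotE u w :
  dot u w = u 0 0 * w 0 0 + u 0 1 * w 0 1 + u 0 2%:R * w 0 2%:R.
Proof.
rewrite /dot mxE !big_ord_recl big_ord0 addr0 !mxE addrA.
by congr (_ + u 0 _ * w 0 _ + u 0 _ * w 0 _); apply: val_inj.
Qed.

Lemma crossE u w :
  [/\ (cross u w) 0 0 = u 0 1 * w 0 2%:R - u 0 2%:R * w 0 1,
      (cross u w) 0 1 = u 0 2%:R * w 0 0 - u 0 0 * w 0 2%:R
    & (cross u w) 0 2%:R = u 0 0 * w 0 1 - u 0 1 * w 0 0].
Proof.
by split; rewrite mxE; congr (u 0 _ * w 0 _ - u 0 _ * w 0 _); apply: val_inj.
Qed.

Lemma row3P u w :
  u 0 0 = w 0 0 -> u 0 1 = w 0 1 -> u 0 2%:R = w 0 2%:R -> u = w.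
Proof.
move=> e0 e1 e2; apply/rowP => -[[|[|[|//]]] i3].
- by rewrite (_ : Ordinal _ = 0) //; apply: val_inj.
- by rewrite (_ : Ordinal _ = 1) //; apply: val_inj.
- by rewrite (_ : Ordinal _ = 2%:R) //; apply: val_inj.
Qed.

Lemma dotC u w : dot u w = dot w u.
Proof. by rewrite !dotE; ring. Qed.

Lemma dotDl u w x : dot (u + w) x = dot u x + dot w x.
Proof. by rewrite !dotE !mxE; ring. Qed.

Lemma dotZl a u x : dot (a *: u) x = a * dot u x.
Proof. by rewrite !dotE !mxE; ring. Qed.

Lemma dotDr u w x : dot x (u + w) = dot x u + dot x w.
Proof. by rewrite !dotE !mxE; ring. Qed.

Lemma dotZr a u x : dot x (a *: u) = a * dot x u.
Proof. by rewrite !dotE !mxE; ring. Qed.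

Lemma dot0l x : dot 0 x = 0.
Proof. by rewrite !dotE !mxE; ring. Qed.

Lemma dot0r x : dot x 0 = 0.
Proof. by rewrite dotC dot0l. Qed.

Lemma dotuu_ge0 u : 0 <= dot u u.
Proof. by rewrite dotE !addr_ge0 // -expr2 sqr_ge0. Qed.

Lemma crossDl u w x : cross (u + w) x = cross u x + cross w x.
Proof. by apply/rowP => j; rewrite !mxE; ring. Qed.

Lemma crossZl a u x : cross (a *: u) x = a *: cross u x.
Proof. by apply/rowP => j; rewrite !mxE; ring. Qed.

Lemma crossDr u w x : cross x (u + w) = cross x u + cross x w.
Proof. by apply/rowP => j; rewrite !mxE; ring. Qed.

Lemma crossZr a u x : cross x (a *: u) = a *: cross x u.
Proof. by apply/rowP => j; rewrite !mxE; ring. Qed.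

Lemma cross0r u : cross u 0 = 0.
Proof. by apply/rowP => j; rewrite !mxE; ring. Qed.

Lemma crossC u w : cross u w = - cross w u.
Proof. by apply/rowP => j; rewrite !mxE; ring. Qed.

Lemma cross_self u : cross u u = 0.
Proof. by apply/rowP => j; rewrite !mxE; ring. Qed.

(** Lagrange's formula for the vector triple product, the source of all later identities in the
    frame. *)
Lemma cross_cross u w x : cross u (cross w x) = dot u x *: w - dot u w *: x.
Proof.
have [x0 x1 x2] := crossE w x; have [y0 y1 y2] := crossE u (cross w x).
by apply: row3P; rewrite ?(y0, y1, y2) ?(x0, x1, x2) !dotE !mxE; ring.
Qed.

(** Cyclic symmetry of the scalar triple product, i.e. of the determinant. *)
Lemma dot_cross_cycle u w x : dot (cross u w) x = dot (cross w x) u.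
Proof.
have [x0 x1 x2] := crossE u w; have [y0 y1 y2] := crossE w x.
by rewrite !dotE x0 x1 x2 y0 y1 y2; ring.
Qed.

Lemma dot_crossl u w : dot (cross u w) u = 0.
Proof. by rewrite dot_cross_cycle dot_cross_cycle cross_self dot0l. Qed.

Lemma dot_crossr u w : dot (cross u w) w = 0.
Proof. by rewrite dot_cross_cycle cross_self dot0l. Qed.

Definition orthonormal2 T N := [/\ dot T T = 1, dot N N = 1 & dot T N = 0].

(** The third frame vector is built in as [cross T N], so orthonormality of the pair [T], [N]
    already makes this a positively oriented orthonormal frame. *)
Definition frame_comb T N a b c : 'rV[R]_3 := a *: T + b *: N + c *: cross T N.

Variables T N : 'rV[R]_3.
Context (TN : orthonormal2 T N).

Lemma dot_binormal : dot (cross T N) (cross T N) = 1.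
Proof.
case: TN => TT NN TN0.
rewrite dot_cross_cycle cross_cross dotDl -scaleNr !dotZl dotC TN0 TT NN.
by ring.
Qed.

Lemma dot_frame_comb a b c a' b' c' :
  dot (frame_comb T N a b c) (frame_comb T N a' b' c') =
  a * a' + b * b' + c * c'.
Proof.
case: (TN) => TT NN TN0.
rewrite !(dotDl, dotDr, dotZl, dotZr) dot_binormal dot_crossl dot_crossr.
rewrite ![dot _ (cross _ _)]dotC dot_crossl dot_crossr [dot N T]dotC TT NN TN0.
by ring.
Qed.

(** With $B = T \times N$, Lagrange's formula gives $N \times B = T$ and $T \times B = -N$;
    bilinearity does the rest. *)
Lemma cross_frame_comb a b c a' b' c' :
  cross (frame_comb T N a b c) (frame_comb T N a' b' c') =
  frame_comb T N (b * c' - c * b') (c * a' - a * c') (a * b' - b * a').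
Proof.
case: (TN) => TT NN TN0.
have eNB : cross N (cross T N) = T.
  by rewrite cross_cross NN [dot N T]dotC TN0 scale1r scale0r subr0.
have eTB : cross T (cross T N) = - N.
  by rewrite cross_cross TT TN0 scale1r scale0r sub0r.
rewrite /frame_comb !(crossDl, crossDr, crossZl, crossZr) !cross_self.
rewrite eNB eTB [cross (cross T N) T]crossC [cross (cross T N) N]crossC eNB eTB.
rewrite [cross N T]crossC.
by apply/rowP => j; rewrite !mxE; ring.
Qed.

(** That the three vectors span is obtained from Lagrange's formula instead of a dimension count:
    the part [w] of [u] orthogonal to [N] is recovered from $T \times (w \times T) = w - \langle T,
    w\rangle T$. *)
Lemma frame_decomp u :
  u = frame_comb T N (dot u T) (dot u N) (dot u (cross T N)).
Proof.
case: (TN) => TT NN TN0.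
have NT0 : dot N T = 0 by rewrite dotC.
pose w := u - dot u N *: N.
have wN : dot N w = 0.
  by rewrite dotDr -scaleNr dotZr NN [dot N u]dotC; ring.
(* As [w] and [T] are orthogonal to [N], $N \times (w \times T) = 0$; crossing once more with [N]
   shows that $w \times T$ equals its projection on [N]. *)
have uT : cross w T = dot w (cross T N) *: N.
  have := cross_cross N N (cross w T).
  rewrite [cross N (cross w T)]cross_cross NT0 wN !scale0r subrr NN scale1r.
  rewrite cross0r => /esym /subr0_eq <-; congr (_ *: _).
  by rewrite [LHS]dotC dot_cross_cycle [RHS]dotC.
have := cross_cross T w T; rewrite uT crossZr TT scale1r.
have -> : dot w (cross T N) = dot u (cross T N).
  by rewrite dotDl -scaleNr dotZl [dot N _]dotC dot_crossr; ring.
have -> : dot T w = dot u T by rewrite dotDr -scaleNr dotZr TN0 dotC; ring.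
move=> e; rewrite /frame_comb e /w.
by apply/rowP => j; rewrite !mxE; ring.
Qed.

End VectorAlgebra.

(** * Differentiation rules for vector-valued functions *)

Section VectorCalculus.
Variable R : realType.
Implicit Types (f g : R -> 'rV[R]_3) (h : R -> R) (t : R).

(** Reduces the product rules below to the scalar rules, coordinate by coordinate. *)
Lemma is_derive_rowP f t (df : 'rV[R]_3) :
  is_derive t 1 f df <->
  forall j, is_derive t 1 (fun x => f x 0 j : R) (df 0 j).
Proof.
split=> [[df1 <-] j|H].
  have := derivable_mxP f t 1; case=> /(_ df1) H _.
  by rewrite derive_mx // mxE; apply: DeriveDef.
have df1 : derivable f t 1.
  by apply/derivable_mxP => i j; rewrite ord1; case: (H j).
apply: DeriveDef => //; apply/rowP => j.
by rewrite derive_mx // mxE; case: (H j).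
Qed.

Lemma is_derive_scale h f t (dh : R) (df : 'rV[R]_3) :
  is_derive t 1 h dh -> is_derive t 1 f df ->
  is_derive t 1 (fun x => h x *: f x) (dh *: f t + h t *: df).
Proof.
move=> hh /is_derive_rowP hf; apply/is_derive_rowP => j.
rewrite (_ : (fun x => _) = h * (fun x => f x 0 j)); last first.
  by apply/funext => x; rewrite mxE.
apply: (is_derive_eq (is_deriveM hh (hf j))).
by rewrite !mxE /GRing.scale /=; ring.
Qed.

Lemma is_derive_dot f g t (df dg : 'rV[R]_3) :
  is_derive t 1 f df -> is_derive t 1 g dg ->
  is_derive t 1 (fun x => dot (f x) (g x)) (dot df (g t) + dot (f t) dg).
Proof.
move=> /is_derive_rowP hf /is_derive_rowP hg.
pose m j := (fun x => f x 0 j : R) * (fun x => g x 0 j : R).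
rewrite (_ : (fun x => _) = m 0 + m 1 + m 2%:R); last first.
  by apply/funext => x; rewrite dotE.
apply: (is_derive_eq (is_deriveD (is_deriveD (is_deriveM (hf 0) (hg 0))
  (is_deriveM (hf 1) (hg 1))) (is_deriveM (hf 2%:R) (hg 2%:R)))).
by rewrite !dotE /GRing.scale /=; ring.
Qed.

Lemma is_derive_cross f g t (df dg : 'rV[R]_3) :
  is_derive t 1 f df -> is_derive t 1 g dg ->
  is_derive t 1 (fun x => cross (f x) (g x)) (cross df (g t) + cross (f t) dg).
Proof.
move=> /is_derive_rowP hf /is_derive_rowP hg; apply/is_derive_rowP => j.
pose m i k := (fun x => f x 0 i : R) * (fun x => g x 0 k : R).
rewrite (_ : (fun x => _) =
    m (j + 1) (j + 2%:R) - m (j + 2%:R) (j + 1)); last first.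
  by apply/funext => x; rewrite mxE.
apply: (is_derive_eq (is_deriveB (is_deriveM (hf (j + 1)) (hg (j + 2%:R)))
  (is_deriveM (hf (j + 2%:R)) (hg (j + 1))))).
by rewrite !mxE /GRing.scale /=; ring.
Qed.

(** Serves to differentiate relations such as $\langle T, T\rangle = 1$, which are known on the open
    set [I] only. *)
Lemma is_derive_near_cst (V : normedModType R) (f : R -> V) t (k df : V) :
  (\forall x \near t, f x = k) -> is_derive t 1 f df -> df = 0.
Proof.
move=> nf hf.
have [_ <-] := near_eq_is_derive nf hf.
by rewrite (_ : (fun=> k) = cst k) // derive_cst.
Qed.

Lemma derive1_val (V : normedModType R) (f : R -> V) t (df : V) :
  is_derive t 1 f df -> derive1 f t = df.
Proof. by move=> [_ <-]; rewrite derive1E. Qed.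

Lemma is_derive_derive1 (V : normedModType R) (f : R -> V) t :
  derivable f t 1 -> is_derive t 1 f (derive1 f t).
Proof. by rewrite derive1E => /derivableP. Qed.

Lemma is_derive_sqrt_comp h t (dh : R) : 0 < h t ->
  is_derive t 1 h dh ->
  is_derive t 1 (fun x => Num.sqrt (h x)) ((2 * Num.sqrt (h t))^-1 * dh).
Proof.
move=> h0 hh; apply: (@is_derive1_comp _ Num.sqrt h) => //.
exact: is_derive1_sqrt.
Qed.

End VectorCalculus.

(** * The shape operator at points with orthonormal partial derivatives *)

Section ShapeOperator.
Variable R : realType.

(** Orthonormality reads $D D^T = 1$, so [D] has full row rank and [pinvmx D] is a right inverse of
    it; hence $S$ sends $cD$ to $-c$ times the differential of the unit normal. *)
Lemma shape_operator_orthonormal (X : R * R -> 'rV[R]_3) (x : R * R)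
    (T B : 'rV[R]_3) :
  partial_s X x = T -> partial_v X x = B -> orthonormal2 T B ->
  shape_operator X x T = - partial_s (unit_normal X) x /\
  shape_operator X x B = - partial_v (unit_normal X) x.
Proof.
move=> eT eB [TT BB TB0]; set D := differential_mx X x.
have DD : D *m D^T = 1%:M.
  rewrite /D /differential_mx eT eB tr_col_mx mul_col_row [RHS]scalar_mx_block.
  suff e u w : u *m w^T = (dot u w)%:M :> 'M[R]_1.
    by rewrite !e TT BB TB0 dotC TB0 raddf0.
  by rewrite [LHS]mx11_scalar.
have Df : row_free D by apply/row_freeP; exists D^T.
have S (c : 'rV[R]_(1 + 1)) :
    shape_operator X x (c *m D) = - (c *m differential_mx (unit_normal X) x).
  by rewrite /shape_operator -/D -(mulmxA c) mulmxVp // mulmx1.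
(* The rows $(1,0)$ and $(0,1)$ are the coordinates of [T] and [B] in the basis of partial
   derivatives. *)
have sel1 (u w : 'rV[R]_3) : row_mx 1%:M 0 *m col_mx u w = u.
  by rewrite mul_row_col mul1mx mul0mx addr0.
have sel2 (u w : 'rV[R]_3) : row_mx 0 1%:M *m col_mx u w = w.
  by rewrite mul_row_col mul1mx mul0mx add0r.
have eD : D = col_mx T B by rewrite /D /differential_mx eT eB.
split.
- rewrite -[in LHS](sel1 T B) -[X in _ *m X]eD S; congr (- _); exact: sel1.
- rewrite -[in LHS](sel2 T B) -[X in _ *m X]eD S; congr (- _); exact: sel2.
Qed.

Lemma nfree2P (u w : 'rV[R]_3) : w != 0 ->
  reflect (exists k, u = k *: w) (~~ free [:: u; w]).
Proof.
move=> w0; rewrite free_cons span_seq1 seq1_free w0 andbT negbK.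
by apply/(iffP idP) => [/vlineP|] [k ->]; [exists k|rewrite memvZ ?memv_line].
Qed.

End ShapeOperator.

(** * The Frenet frame and its derivative equations *)

Section FrenetFrame.
Variables (R : realType) (I : set R) (alpha : R -> 'rV[R]_3).
Context (hI : open_interval I) (hsmooth : smooth_on I alpha)
  (hunit : unit_speed I alpha)
  (hkappa : forall s, I s -> curvature alpha s != 0).

Let A n := derive1n n alpha.
Let T := tangent alpha.
Let N := normal alpha.
Let B := binormal alpha.
Let kappa := curvature alpha.
Let tau := torsion alpha.

Lemma near_I s : I s -> \forall x \near s, I x.
Proof. by case: hI => _ oI _ Is; apply: open_nbhs_nbhs. Qed.

Lemma is_derive_derive1n n s : I s -> is_derive s 1 (A n) (A n.+1 s).
Proof. by move=> Is; apply: is_derive_derive1; exact: hsmooth. Qed.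

Lemma curvature_gt0 s : I s -> 0 < kappa s.
Proof. by move=> Is; rewrite lt_def hkappa // sqrtr_ge0. Qed.

Lemma curvature_sqr s : kappa s ^+ 2 = dot (A 2 s) (A 2 s).
Proof. by rewrite sqr_sqrtr // dotuu_ge0. Qed.

Lemma tangent_unit s : I s -> dot (T s) (T s) = 1.
Proof.
move=> /hunit; rewrite /enorm => e.
by rewrite -[LHS]sqr_sqrtr ?dotuu_ge0 // e expr1n.
Qed.

Lemma derive_tangent s : I s -> A 2 s = kappa s *: N s.
Proof.
move=> Is; rewrite /N /normal -/(curvature alpha s) scalerA mulfV ?scale1r //.
exact: hkappa.
Qed.

Lemma is_derive_tangent s : I s -> is_derive s 1 T (kappa s *: N s).
Proof.
move=> Is; apply: (is_derive_eq (is_derive_derive1n 1 Is)).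
exact: derive_tangent.
Qed.

Lemma normal_unit s : I s -> dot (N s) (N s) = 1.
Proof.
move=> Is; rewrite dotZl dotZr -curvature_sqr -/(curvature alpha s) -/kappa.
by field; exact: hkappa.
Qed.

(** Differentiating $\langle T, T\rangle = 1$ gives $2\kappa\langle T, N\rangle = 0$, and $\kappa >
    0$. *)
Lemma dot_tangent_normal s : I s -> dot (T s) (N s) = 0.
Proof.
move=> Is.
have dT := is_derive_tangent Is.
have : dot (kappa s *: N s) (T s) + dot (T s) (kappa s *: N s) = 0.
  apply: is_derive_near_cst (is_derive_dot dT dT) => //.
  apply: filterS (near_I Is) => x; exact: tangent_unit.
rewrite [X in X + _]dotC dotZr -mulr2n => /eqP; rewrite mulrn_eq0 mulf_eq0 /=.
by rewrite gt_eqF ?curvature_gt0 //= => /eqP.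
Qed.

Lemma orthonormal_frame s : I s -> orthonormal2 (T s) (N s).
Proof.
by move=> Is; split; [exact: tangent_unit|exact: normal_unit|
  exact: dot_tangent_normal].
Qed.

(** Quotient rule for $N = \alpha''/\sqrt{\langle\alpha'',\alpha''\rangle}$. The coefficient [a]
    stays implicit because its term drops out of the torsion: $\langle T \times \alpha'',
    \alpha''\rangle = 0$. *)
Lemma is_derive_normal_expansion s : I s ->
  exists a : R, is_derive s 1 N (a *: A 2 s + (kappa s)^-1 *: A 3 s).
Proof.
move=> Is; have dA := is_derive_derive1n 2 Is.
have k0 : 0 < dot (A 2 s) (A 2 s).
  by rewrite -curvature_sqr exprn_gt0 // curvature_gt0.
have := is_derive_scale (is_deriveV (hkappa Is)
  (is_derive_sqrt_comp k0 (is_derive_dot dA dA))) dA.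
by eexists; eassumption.
Qed.

Lemma is_derive_normal s : I s -> is_derive s 1 N (derive1 N s).
Proof.
by move=> /is_derive_normal_expansion [a dN]; rewrite (derive1_val dN).
Qed.

Lemma is_derive_binormal_cross s : I s ->
  is_derive s 1 B (cross (T s) (derive1 N s)).
Proof.
move=> Is.
apply: (is_derive_eq
  (is_derive_cross (is_derive_tangent Is) (is_derive_normal Is))).
by rewrite crossZl cross_self scaler0 add0r.
Qed.

Lemma is_derive_binormal s : I s -> is_derive s 1 B (- tau s *: N s).
Proof.
move=> Is; have F := orthonormal_frame Is.
have dB := is_derive_binormal_cross Is.
apply: (is_derive_eq dB).
rewrite [LHS](frame_decomp F) /frame_comb dot_crossl scale0r add0r.
have : dot (cross (T s) (derive1 N s)) (B s) +
    dot (B s) (cross (T s) (derive1 N s)) = 0.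
  apply: is_derive_near_cst (is_derive_dot dB dB) => //.
  apply: filterS (near_I Is) => x Ix; exact: dot_binormal (orthonormal_frame Ix).
rewrite [X in _ + X]dotC -mulr2n => /eqP; rewrite mulrn_eq0 /= => /eqP ->.
by rewrite scale0r addr0 /tau /torsion (derive1_val dB) opprK.
Qed.

(** The three coordinates of $N'$ come from differentiating $\langle T, N\rangle = 0$, $\langle N,
    N\rangle = 1$ and $\langle N, B\rangle = 0$ in turn. *)
Lemma derive_normalE s : I s ->
  derive1 N s = frame_comb (T s) (N s) (- kappa s) 0 (tau s).
Proof.
move=> Is; have F := orthonormal_frame Is; case: (F) => TT NN TN0.
have dT := is_derive_tangent Is; have dN := is_derive_normal Is.
have dB := is_derive_binormal Is.
rewrite [LHS](frame_decomp F); congr frame_comb.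
- have : dot (kappa s *: N s) (N s) + dot (T s) (derive1 N s) = 0.
    apply: is_derive_near_cst (is_derive_dot dT dN) => //.
    apply: filterS (near_I Is) => x; exact: dot_tangent_normal.
  by rewrite dotZl NN mulr1 [dot (T s) _]dotC addrC => /eqP; rewrite addr_eq0 => /eqP.
- have : dot (derive1 N s) (N s) + dot (N s) (derive1 N s) = 0.
    apply: is_derive_near_cst (is_derive_dot dN dN) => //.
    apply: filterS (near_I Is) => x; exact: normal_unit.
  by rewrite [X in _ + X]dotC -mulr2n => /eqP; rewrite mulrn_eq0 /= => /eqP.
- have : dot (derive1 N s) (B s) + dot (N s) (- tau s *: N s) = 0.
    apply: is_derive_near_cst (is_derive_dot dN dB) => //.
    apply: filterS (near_I Is) => x Ix.
    by rewrite dotC dot_crossr.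
  by rewrite dotZr NN mulr1 => /subr0_eq.
Qed.

(* This expression, unlike the definition, involves only derivatives of
   [alpha], hence is visibly differentiable. *)
Lemma torsion_triple s : I s ->
  tau s = - (dot (A 2 s) (A 2 s))^-1 * dot (cross (T s) (A 3 s)) (A 2 s).
Proof.
move=> Is; have [a dN] := is_derive_normal_expansion Is.
rewrite /tau /torsion (derive1_val (is_derive_binormal_cross Is)) (derive1_val dN).
have -> : normal alpha s = (kappa s)^-1 *: A 2 s by [].
have k0 : kappa s != 0 by exact: hkappa.
move: (curvature_sqr s) k0.
move: (kappa s) (T s) (A 2 s) (A 3 s) => k t u w <- k0.
rewrite crossDr 2!crossZr dotDl 2!dotZl 2!dotZr dot_crossr.
by field.
Qed.

(** The triple product formula is differentiable and agrees with [tau] on a neighbourhood of [s], as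
    [I] is open. *)
Lemma is_derive_torsion s : I s -> is_derive s 1 tau (derive1 tau s).
Proof.
move=> Is; apply: is_derive_derive1.
have d1 := is_derive_derive1n 1 Is; have d2 := is_derive_derive1n 2 Is.
have d3 := is_derive_derive1n 3 Is.
have k0 : dot (A 2 s) (A 2 s) != 0 by rewrite -curvature_sqr expf_neq0 // hkappa.
have dt := is_deriveM (is_deriveN (is_deriveV k0 (is_derive_dot d2 d2)))
  (is_derive_dot (is_derive_cross d1 d3) d2).
have ntau : \forall x \near s,
    - (dot (A 2 x) (A 2 x))^-1 * dot (cross (T x) (A 3 x)) (A 2 x) = tau x.
  by apply: filterS (near_I Is) => x Ix; rewrite torsion_triple.
by have [] := near_eq_is_derive ntau dt.
Qed.

(** * Partial derivatives, acceleration and unit normal of the binormal surface *)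

Let K := binormal_surface alpha.

Lemma is_derive_surface_s v s : I s ->
  is_derive s 1 (fun x => K (x, v))
    (frame_comb (T s) (N s) 1 (- (v * tau s)) 0).
Proof.
move=> Is.
apply: (is_derive_eq
  (is_deriveD (is_derive_derive1n 0 Is) (is_deriveZ v (is_derive_binormal Is)))).
by rewrite /frame_comb scale1r scale0r addr0 scalerA mulrN.
Qed.

Lemma partial_s_surface v s : I s ->
  partial_s K (s, v) = frame_comb (T s) (N s) 1 (- (v * tau s)) 0.
Proof. by move=> Is; rewrite /partial_s (derive1_val (is_derive_surface_s v Is)). Qed.

(** Differentiate $K_s = T - v\tau N$, valid near [s], and substitute $T' = \kappa N$ and $N' =
    -\kappa T + \tau B$. *)
Lemma acceleration_s v s : I s ->
  derive1n 2 (K \o s_curve v) s =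
  frame_comb (T s) (N s) (v * kappa s * tau s) (kappa s - v * derive1 tau s)
    (- (v * tau s ^+ 2)).
Proof.
move=> Is.
have dv := is_deriveD (is_derive_tangent Is)
  (is_derive_scale (is_deriveN (is_deriveZ v (is_derive_torsion Is)))
    (is_derive_normal Is)).
have nK : \forall x \near s, T x + (- (v *: tau x)) *: N x =
    derive1 (K \o s_curve v) x.
  apply: filterS (near_I Is) => x Ix.
  rewrite (derive1_val (is_derive_surface_s v Ix)) /frame_comb.
  by rewrite scale1r scale0r addr0.
rewrite [LHS](derive1_val (near_eq_is_derive nK dv)) derive_normalE // /frame_comb.
rewrite (_ : (- (v *: tau)) s = - (v * tau s)) //.
move: (T s) (N s) (cross _ _) (kappa s) (tau s) (derive1 tau s) => t n b k u u'.
apply/rowP => j; rewrite !mxE /GRing.scale /=; ring.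
Qed.

Lemma is_derive_surface_v (v s : R) :
  is_derive v 1 (fun x => K (s, x)) (B s).
Proof.
have := is_deriveD (is_derive_cst (alpha s) v 1)
  (is_derive_scale (is_derive_id v 1) (is_derive_cst (B s) v 1)).
by rewrite add0r scaler0 addr0 scale1r; apply.
Qed.

Lemma partial_v_surface (v s : R) : partial_v K (s, v) = B s.
Proof. by rewrite /partial_v (derive1_val (is_derive_surface_v v s)). Qed.

(** $(T - v\tau N) \times B = -v\tau T - N$ has squared length $1 + (v\tau)^2 > 0$, so the surface
    is regular over all of [I]. *)
Lemma unit_normal_surface v s : I s ->
  unit_normal K (s, v) = (Num.sqrt (1 + (v * tau s) ^+ 2))^-1 *:
    frame_comb (T s) (N s) (- (v * tau s)) (- 1) 0.
Proof.
move=> Is; have F := orthonormal_frame Is.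
have eB : B s = frame_comb (T s) (N s) 0 0 1.
  by rewrite /frame_comb !scale0r !add0r scale1r.
rewrite /unit_normal partial_s_surface // partial_v_surface eB.
rewrite cross_frame_comb // /enorm dot_frame_comb //.
by congr ((Num.sqrt _)^-1 *: frame_comb _ _ _ _ _); ring.
Qed.

(** * Asymptotic and geodesic $s$-parameter curves *)

Lemma unit_normal_scale_gt0 v s : 0 < (Num.sqrt (1 + (v * tau s) ^+ 2))^-1.
Proof. by rewrite invr_gt0 sqrtr_gt0 ltr_pwDl // sqr_ge0. Qed.

(** $\langle U, K_{ss}\rangle$ is the left side of the differential equation times the positive
    normalizing factor of $U$. *)
Lemma asymptotic_s_curve v :
  asymptotic_curve K I (s_curve v) <->
  (forall s, I s ->
     v * derive1 tau s - v ^+ 2 * kappa s * tau s ^+ 2 - kappa s = 0).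
Proof.
have E s : I s -> dot (unit_normal K (s_curve v s)) (derive1n 2 (K \o s_curve v) s) =
    (Num.sqrt (1 + (v * tau s) ^+ 2))^-1 *
    (v * derive1 tau s - v ^+ 2 * kappa s * tau s ^+ 2 - kappa s).
  move=> Is; rewrite acceleration_s // unit_normal_surface // dotZl.
  by rewrite dot_frame_comb; [congr (_ * _); ring|exact: orthonormal_frame].
split=> H s Is; last by rewrite E // H // mulr0.
have /eqP := H s Is; rewrite E // mulf_eq0 gt_eqF ?unit_normal_scale_gt0 //=.
by move/eqP.
Qed.

(** Up to a positive factor, $U \times K_{ss}$ has coordinates $v\tau^2$, $-v^2\tau^3$,
    $v^2\tau\tau'$. The first one forces $v = 0$ or $\tau = 0$, and all three contain the factor
    $v\tau$. *)
Lemma geodesic_s_curve v :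
  geodesic_curve K I (s_curve v) <-> (v = 0 \/ plane_curve alpha I).
Proof.
have E s : I s ->
    cross (unit_normal K (s_curve v s)) (derive1n 2 (K \o s_curve v) s) =
    (Num.sqrt (1 + (v * tau s) ^+ 2))^-1 *:
    frame_comb (T s) (N s) (v * tau s ^+ 2) (- (v ^+ 2 * tau s ^+ 3))
      (v ^+ 2 * tau s * derive1 tau s).
  move=> Is; rewrite acceleration_s // unit_normal_surface // crossZl.
  rewrite cross_frame_comb; last exact: orthonormal_frame.
  by congr (_ *: frame_comb _ _ _ _ _); ring.
split=> [H|vtau s Is].
  have [v0|v0] := eqVneq v 0; [by left|right=> s Is].
  have := H s Is; rewrite E // => /eqP; rewrite scaler_eq0.
  rewrite gt_eqF ?unit_normal_scale_gt0 //=.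
  (* Pairing with $T$ extracts the coordinate $v\tau^2$. *)
  move=> /eqP /(congr1 (dot (frame_comb (T s) (N s) 1 0 0))).
  rewrite dot_frame_comb; last exact: orthonormal_frame.
  rewrite [RHS]dot0r mul1r !mul0r !addr0 => /eqP.
  by rewrite mulf_eq0 (negbTE v0) sqrf_eq0 => /eqP.
have vt0 : v * tau s = 0.
  by case: vtau => [->|/(_ s Is) e]; rewrite ?mul0r // /tau e mulr0.
rewrite E // (_ : v * tau s ^+ 2 = 0); last by rewrite expr2 mulrA vt0 mul0r.
rewrite (_ : v ^+ 2 * tau s ^+ 3 = (v * tau s) ^+ 2 * tau s); last by ring.
rewrite (_ : v ^+ 2 * tau s = (v * tau s) * v); last by ring.
by rewrite vt0 expr0n !mul0r /frame_comb oppr0 !scale0r !addr0 scaler0.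
Qed.

(** * Straight $v$-parameter curves and lines of curvature *)

Lemma binormal_neq0 s : I s -> B s != 0.
Proof.
move=> Is; apply/eqP => B0; have := dot_binormal (orthonormal_frame Is).
by move/eqP; rewrite -/(binormal alpha s) -/B B0 dot0l eq_sym oner_eq0.
Qed.

(** The image is by definition the line through [alpha s] directed by [B s], so it remains to see
    that this direction is nonzero. *)
Lemma v_curve_straight s : I s -> straight_line setT (K \o v_curve s).
Proof.
by move=> Is; exists (alpha s), (B s); split; first exact: binormal_neq0.
Qed.

(** The condition $v\tau = 0$ covers both uses: the base curve $v = 0$, and every $v$ when $\tau =
    0$. *)
Lemma orthonormal_partials v s : I s -> v * tau s = 0 ->
  [/\ partial_s K (s, v) = T s, partial_v K (s, v) = B s &
      orthonormal2 (T s) (B s)].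
Proof.
move=> Is vt0; rewrite partial_s_surface // partial_v_surface vt0; split=> //.
  by rewrite /frame_comb oppr0 !scale0r !addr0 scale1r.
have F := orthonormal_frame Is; split; first by case: F.
- exact: dot_binormal.
- by rewrite dotC dot_crossl.
Qed.

(* The scalar [w] is in fact 0, but the coefficient of [T] is all that matters. *)
Lemma partial_v_unit_normal s : I s ->
  exists w : R, partial_v (unit_normal K) (s, 0) =
    frame_comb (T s) (N s) (- tau s) w 0.
Proof.
move=> Is.
(* The radicand in the normalizing factor of $U$, with the square written as a product to fit the
   product rule. *)
pose W (v : R) : R := 1 + (v * tau s) * (v * tau s).
have W0 : W 0 = 1 by rewrite /W !mul0r addr0.
have dvt := is_deriveM (is_derive_id (0 : R) (1 : R)) (is_derive_cst (tau s) (0 : R) (1 : R)).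
have dp := is_deriveD (is_derive_cst (1 : R) (0 : R) (1 : R)) (is_deriveM dvt dvt).
have p0 : 0 < W 0 by rewrite W0.
have sp0 : Num.sqrt (W 0) != 0 by rewrite W0 sqrtr1 oner_eq0.
have dW := is_deriveV (f := fun v => Num.sqrt (W v)) sp0
  (is_derive_sqrt_comp p0 dp).
have dm := is_derive_scale (is_deriveM (is_derive_id (0 : R) (1 : R))
  (is_derive_cst (- tau s) (0 : R) (1 : R))) (is_derive_cst (T s) (0 : R) (1 : R)).
have := derive1_val (is_derive_scale dW (is_deriveD dm (is_derive_cst (- N s) (0 : R) (1 : R)))).
(* Here [w] is the derivative at 0 of the normalizing factor; it multiplies $-N$, the value at 0 of
   the unnormalized normal, whence the sign. *)
set w := (X in X *: _ + _) => dU; exists (- w).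
rewrite /partial_v /= (_ : (fun v => _) = fun v : R => (Num.sqrt (W v))^-1 *:
    ((v * - tau s) *: T s + (- N s))); last first.
  apply/funext => v; rewrite unit_normal_surface // /W -expr2.
  by rewrite /frame_comb [v * - tau s]mulrN scaleN1r scale0r addr0.
rewrite [LHS]dU /= W0 sqrtr1 invr1 scale1r /frame_comb.
rewrite [X in w *: X](_ : _ = - N s); last first.
  by rewrite -[LHS]/((0 * - tau s) *: T s - N s) mul0r scale0r add0r.
rewrite [X in X *: T s + _](_ : _ = - tau s); last first.
  by rewrite scale0r add0r; exact: mulr1.
by rewrite scaler0 !addr0 scale0r addr0 scalerN -scaleNr addrC.
Qed.

Lemma lines_of_curvature :
  ((forall v : R, line_of_curvature K I (s_curve v)) /\
   (forall s, I s -> line_of_curvature K setT (v_curve s))) <->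
  plane_curve alpha I.
Proof.
split=> [[_ H] s Is|H].
  have [eT eB oTB] := orthonormal_partials Is (mul0r (tau s)).
  have := H s Is 0 Logic.I; rewrite /= (derive1_val (is_derive_surface_v 0 s)).
  have [_ ->] := shape_operator_orthonormal eT eB oTB.
  move=> /(nfree2P _ (binormal_neq0 Is)) [k].
  have [w ->] := partial_v_unit_normal Is.
  (* The relation $-U_v = kB$ paired with $T$ reads $\tau = 0$. *)
  move=> /(congr1 (dot (frame_comb (T s) (N s) 1 0 0))).
  have -> : B s = frame_comb (T s) (N s) 0 0 1.
    by rewrite /frame_comb !scale0r !add0r scale1r.
  rewrite -scaleN1r !dotZr !dot_frame_comb; try exact: orthonormal_frame.
  by rewrite !mul1r !mul0r !addr0 mulr0 mulN1r opprK.
have U s v : I s -> unit_normal K (s, v) = - N s.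
  move=> Is; rewrite unit_normal_surface // /tau H // mulr0 expr0n addr0 sqrtr1.
  by rewrite invr1 scale1r /frame_comb oppr0 !scale0r add0r addr0 scaleN1r.
split=> [v s Is|s Is v _] /=.
  have vt0 : v * tau s = 0 by rewrite /tau H // mulr0.
  have [eT eB oTB] := orthonormal_partials Is vt0.
  have [ST _] := shape_operator_orthonormal eT eB oTB.
  have -> : derive1 (K \o s_curve v) s = T s := eT.
  have T0 : T s != 0.
    apply/eqP => T0; have := tangent_unit Is.
    by move/eqP; rewrite T0 dot0l eq_sym oner_eq0.
  (* The factor comes from $S(T) = -U_s = N' = -\kappa T$ when $\tau = 0$. *)
  apply/(nfree2P _ T0); exists (- kappa s); rewrite ST scaleNr; congr (- _).
  have nN : \forall x \near s, - N x = unit_normal K (x, v).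
    by apply: filterS (near_I Is) => x Ix; rewrite U.
  rewrite [LHS](derive1_val (near_eq_is_derive nN (is_deriveN (is_derive_normal Is)))).
  rewrite derive_normalE // /tau H // /frame_comb !scale0r !addr0.
  by rewrite scaleNr opprK.
have vt0 : v * tau s = 0 by rewrite /tau H // mulr0.
have [eT eB oTB] := orthonormal_partials Is vt0.
have [_ SB] := shape_operator_orthonormal eT eB oTB.
rewrite (derive1_val (is_derive_surface_v v s)).
(* The factor is 0 because $U = -N(s)$ is constant along the $v$-parameter curve. *)
apply/(nfree2P _ (binormal_neq0 Is)); exists 0; rewrite SB scale0r.
rewrite /partial_v /= (_ : (fun x => _) = cst (- N s)) ?derive1_cst ?oppr0 //.
by apply/funext => x; rewrite U.
Qed.

End FrenetFrame.

Theorem theorem6 (R : realType) (I : set R) (alpha : R -> 'rV[R]_3)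
    (hI : open_interval I)
    (hsmooth : smooth_on I alpha)
    (hunit : unit_speed I alpha)
    (hkappa : forall s, I s -> curvature alpha s != 0) :
  let K := binormal_surface alpha in
  let kappa := curvature alpha in
  let tau := torsion alpha in
  [/\ forall v : R,
        asymptotic_curve K I (s_curve v) <->
        (forall s, I s ->
           v * derive1 tau s - v ^+ 2 * kappa s * tau s ^+ 2 - kappa s = 0),
      forall v : R,
        geodesic_curve K I (s_curve v) <->
        ((v = 0 /\ (forall s, I s -> K (s, 0) = alpha s)) \/
         plane_curve alpha I),
      forall s, I s -> straight_line setT (K \o v_curve s)
    & ((forall v : R, line_of_curvature K I (s_curve v)) /\
       (forall s, I s -> line_of_curvature K setT (v_curve s))) <->
      plane_curve alpha I].
Proof.
split.
- exact: asymptotic_s_curve.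
- move=> v; rewrite geodesic_s_curve //; split=> -[]; [|by right| |by right].
    (* The clause $K(s,0) = \alpha(s)$ is automatic, as $0 \cdot B$ vanishes. *)
    by move=> ->; left; split=> // s Is; rewrite /binormal_surface scale0r addr0.
  by case=> -> _; left.
- exact: v_curve_straight.
- exact: lines_of_curvature.
Qed.
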